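(* Let $C$ be a single-hole monotone program context (built from the hole $\cdot_p$ by the constructors $\gamma;C'$, $C';\gamma$, $C'\cup\gamma$, $\gamma\cup C'$, $(C')^*$ with hole-free programs $\gamma$), let $\alpha$ be a hybrid program, and let $x$ be a variable. If $x$ is fresh in $C$ (does not occur in $C$) and $x$ is not a free variable of $\alpha$, then the program equivalence $$C(\alpha);\,x:=* \;\equiv\; C(\alpha;\,x:=* );\,x:=*$$ is derivable in dRL.
   Context: Differential refinement logic (dRL). Each real-valued variable $x$ has an associated differential variable $x'$; a state assigns a real to every variable and differential variable. Terms: $e::= x\mid n\mid e+e\mid e\cdot e\mid (e)'$. Hybrid programs: $\alpha,\beta::= ?Q\mid x:=e\mid x:=*\mid \{x'=e\,\&\,Q\}\mid \alpha\cup\beta\mid\alpha;\beta\mid\alpha^*$ with standard transition semantics ($x:=*$ sets $x$ to an arbitrary real). The refinement formula $\alpha\le\beta$ holds in a state $\nu$ iff every state reachable from $\nu$ by $\alpha$ is reachable from $\nu$ by $\beta$; $\alpha\equiv\beta$ abbreviates $\alpha\le\beta\land\beta\le\alpha$. Free variables are the standard (syntactic) free variables of dL/dRL programs. $C(\alpha)$ replaces the hole of $C$ by $\alpha$. Derivability refers to the sound proof calculus of dRL (Loos–Platzer; uniform-substitution version by Prebet–Platzer), including Kleene-algebra-with-tests laws for programs, the axioms for nondeterministic assignments and loops, and the axioms $x':=*;\{x'=f(x)\,\&\,Q(x)\}\equiv\{x'=f(x)\,\&\,Q(x)\}$ and $x:=*;\alpha\equiv\alpha;x:=*$ for $x$ fresh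 for $\alpha$. *)

(* Defs.v *)
From HB Require Import structures.
From Stdlib Require Import Relation_Operators.
From mathcomp Require Import all_boot all_order all_algebra.
From mathcomp Require Import finmap.
From mathcomp Require Import reals topology normedtype derive.

Set Implicit Arguments.
Unset Strict Implicit.
Unset Printing Implicit Defensive.
Import Order.TTheory GRing.Theory Num.Theory.
Import numFieldNormedType.Exports.

Local Open Scope fset_scope.
Local Open Scope fmap_scope.
Local Open Scope ring_scope.

(* [Base i] is the i-th variable, [Diff i] its differential variable. *)
Inductive var := Base of nat | Diff of nat.

Definition var_code (x : var) : nat + nat :=
  match x with Base i => inl i | Diff i => inr i end.
Definition var_decode (c : nat + nat) : var :=
  match c with inl i => Base i | inr i => Diff i end.
Lemma var_codeK : cancel var_code var_decode. Proof. by case. Qed.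
HB.instance Definition _ := Countable.copy var (can_type var_codeK).

Definition is_base (x : var) : bool := if x is Base _ then true else false.

(* There are no second-order differential variables: [prime] fixes x'. *)
Definition prime (x : var) : var := if x is Base i then Diff i else x.

Inductive term :=
  | Var of var
  | Num of rat
  | Add of term & term
  | Mul of term & term
  | Dif of term.

(* [ODE s Q] is {x' = e & Q} for a vector x of distinct variables: [s] maps
   the index of each evolving variable to its right-hand side.  A single
   equation is [ODE [fmap].[i <- e] Q]. *)
Inductive formula :=
  | Ge of term & term
  | Not of formula
  | And of formula & formula
  | All of var & formula
  | Box of program & formula
  | Refines of program & program
with program :=
  | Test of formula
  | Assign of var & term
  | Havoc of var
  | ODE of {fmap nat -> term} & formula
  | Choice of program & program
  | Seq of program & program
  | Loop of program.

Declare Scope drl_scope.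
Delimit Scope drl_scope with drl.
Bind Scope drl_scope with formula program term.

Definition Or p q := Not (And (Not p) (Not q)).
Definition Imp p q := Not (And p (Not q)).
Definition Iff p q := And (Imp p q) (Imp q p).
Definition Ex x p := Not (All x (Not p)).
Definition Dia a p := Not (Box a (Not p)).
Definition Eq e k := And (Ge e k) (Ge k e).
Definition Tt := Ge (Num 0) (Num 0).
Definition Ff := Not Tt.
Definition Equiv a b := And (Refines a b) (Refines b a).

Notation "¬ p" := (Not p)
  (at level 75, right associativity) : drl_scope.
Notation "p ∧ q" := (And p q)
  (at level 80, right associativity) : drl_scope.
Notation "p ∨ q" := (Or p q)
  (at level 85, right associativity) : drl_scope.
Notation "p → q" := (Imp p q)
  (at level 99, q at level 200, right associativity) : drl_scope.
Notation "p ↔ q" := (Iff p q) (at level 95, no associativity) : drl_scope.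
Notation "⟦ a ⟧ p" := (Box a p)
  (at level 70, a at level 200, p at level 70, format "⟦ a ⟧  p") : drl_scope.
Notation "⟨ a ⟩ p" := (Dia a p)
  (at level 70, a at level 200, p at level 70, format "⟨ a ⟩  p") : drl_scope.
Notation "a ≤ b" := (Refines a b) (at level 70, no associativity) : drl_scope.
Notation "a ≡ b" := (Equiv a b) (at level 70, no associativity) : drl_scope.
Notation "a ∪ b" := (Choice a b) (at level 50, left associativity) : drl_scope.
Notation "a ;; b" := (Seq a b) (at level 45, right associativity) : drl_scope.

Fixpoint fvt (e : term) : {fset var} :=
  match e with
  | Var x => [fset x]
  | Num _ => fset0
  | Add e k | Mul e k => fvt e `|` fvt k
  | Dif e => fvt e `|` [fset prime x | x in fvt e]
  end.

Definition ode_dvars (s : {fmap nat -> term}) : {fset var} :=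
  [fset Diff i | i in domf s].

Definition ode_vars (s : {fmap nat -> term}) : {fset var} :=
  [fset Base i | i in domf s] `|` ode_dvars s.

Fixpoint bvp (a : program) : {fset var} :=
  match a with
  | Test _ => fset0
  | Assign x _ | Havoc x => [fset x]
  | ODE s _ => ode_vars s
  | Choice a b | Seq a b => bvp a `|` bvp b
  | Loop a => bvp a
  end.

Fixpoint mbvp (a : program) : {fset var} :=
  match a with
  | Test _ => fset0
  | Assign x _ | Havoc x => [fset x]
  | ODE s _ => ode_vars s
  | Choice a b => mbvp a `&` mbvp b
  | Seq a b => mbvp a `|` mbvp b
  | Loop _ => fset0
  end.

(* A refinement compares entire final states, so its truth value also depends
   on every variable that one of the two programs may, but need not, write on
   some run: x := 1 refines ?true exactly when x is already 1. *)
Fixpoint fvf (p : formula) : {fset var} :=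
  match p with
  | Ge e k => fvt e `|` fvt k
  | Not p => fvf p
  | And p q => fvf p `|` fvf q
  | All x p => fvf p `\ x
  | Box a p => fvp a `|` (fvf p `\` mbvp a)
  | Refines a b =>
      fvp a `|` fvp b `|` ((bvp a `|` bvp b) `\` (mbvp a `&` mbvp b))
  end
with fvp (a : program) : {fset var} :=
  match a with
  | Test q => fvf q
  | Assign _ e => fvt e
  | Havoc _ => fset0
  | ODE s q => [fset Base i | i in domf s]
               `|` \big[fsetU/fset0]_(i : domf s) fvt (s i) `|` fvf q
  | Choice a b => fvp a `|` fvp b
  | Seq a b => fvp a `|` (fvp b `\` mbvp a)
  | Loop a => fvp a
  end.

(* In the static semantics of dL the variables of a program are its free and
   its bound ones; a variable quantified inside a test is neither. *)
Definition varsp (a : program) : {fset var} := fvp a `|` bvp a.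

Definition fresh (x : var) (a : program) : bool := x \notin varsp a.

Section Semantics.
Variable R : realType.

Definition state := var -> R.

(* (e)' denotes the sum of v(x') * (de/dx)(v) over the variables x. *)
Fixpoint evalt (v : state) (e : term) : R :=
  match e with
  | Var x => v x
  | Num c => ratr c
  | Add e k => evalt v e + evalt v k
  | Mul e k => evalt v e * evalt v k
  | Dif e => \sum_(x <- fvt e | is_base x)
      v (prime x) * derive1 (fun r : R => evalt [eta v with x |-> r] e) (v x)
  end.

(* In the clause for ODE, the initial values of the evolving x' are discarded.
   The flow f is defined on all of R and is differentiable there at every time
   of [0, r]; since any solution on [0, r] with one-sided derivatives at the
   end points extends in this way, no run is lost, and r = 0 is a run. *)
Fixpoint sat (v : state) (p : formula) : Prop :=
  match p with
  | Ge e k => evalt v k <= evalt v e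
  | Not p => ~ sat v p
  | And p q => sat v p /\ sat v q
  | All x p => forall r : R, sat [eta v with x |-> r] p
  | Box a p => forall w, run a v w -> sat w p
  | Refines a b => forall w, run a v w -> run b v w
  end
with run (a : program) (v w : state) : Prop :=
  match a with
  | Test q => w = v /\ sat v q
  | Assign x e => w = [eta v with x |-> evalt v e]
  | Havoc x => exists r : R, w = [eta v with x |-> r]
  | ODE s q => exists (r : R) (f : R -> state),
      [/\ 0 <= r, f r = w,
          forall y, y \notin ode_dvars s -> f 0 y = v y
        & forall t, 0 <= t <= r ->
          [/\ sat (f t) q,
              forall y, y \notin ode_vars s -> f t y = v y
            & forall i : domf s,
                f t (Diff (val i)) = evalt (f t) (s i) /\
                is_derive t 1 (fun u => f u (Base (val i)))
                  (f t (Diff (val i)))]]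
  | Choice a b => run a v w \/ run b v w
  | Seq a b => exists2 u, run a v u & run b u w
  | Loop a => clos_refl_trans_1n state (run a) v w
  end.

End Semantics.

Fixpoint peval (v : formula -> bool) (p : formula) : bool :=
  match p with
  | Not p => ~~ peval v p
  | And p q => peval v p && peval v q
  | _ => v p
  end.

Definition tautology (p : formula) : Prop :=
  forall v : formula -> bool, peval v p.

Fixpoint arithmetic (p : formula) : bool :=
  match p with
  | Ge _ _ => true
  | Not p | All _ p => arithmetic p
  | And p q => arithmetic p && arithmetic q
  | Box _ _ | Refines _ _ => false
  end.

(* The system is in explicit form x' = e(x) & Q(x): no x' of the system is
   read by its right-hand sides or its domain. *)
Definition explicit (s : {fmap nat -> term}) (q : formula) : bool :=
  fdisjoint (ode_dvars s) (fvp (ODE s q)).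

Definition ode_holds (s : {fmap nat -> term}) (q : formula) : formula :=
  foldr And q [seq Eq (Var (Diff (val i))) (s i) | i : domf s].

(* Axioms are schemata with syntactic side conditions, which replace the
   argument conventions of predicate and program symbols under uniform
   substitution.  Substitution into formulas is expressed by assignments, which
   [ax_assign_eq] and [ax_assign_ghost] turn into quantified equations.
   Differential terms denote polynomials in x and x', so that validity of
   [arithmetic] formulas is still decidable real arithmetic; the differential
   axioms for constants, variables, sums and products are instances. *)
Inductive derivable (R : realType) : formula -> Prop :=
  | ax_taut p : tautology p -> derivable R p
  | ax_real p :
      arithmetic p -> (forall v : state R, sat v p) -> derivable R p
  | rule_MP p q : derivable R (p → q) -> derivable R p -> derivable R q
  | rule_gen x p : derivable R p -> derivable R (All x p)
  | ax_all_inst x e p : derivable R (All x p → ⟦Assign x e⟧ p)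
  | ax_all_imp x p q : derivable R (All x (p → q) → All x p → All x q)
  | ax_all_vacuous x p : x \notin fvf p -> derivable R (p → All x p)
  | rule_G a p : derivable R p -> derivable R (⟦a⟧ p)
  | ax_K a p q : derivable R (⟦a⟧ (p → q) → ⟦a⟧ p → ⟦a⟧ q)
  | ax_V a p : fdisjoint (fvf p) (bvp a) -> derivable R (p → ⟦a⟧ p)
  | ax_box_test p q : derivable R (⟦Test q⟧ p ↔ (q → p))
  | ax_assign_eq x e p : x \notin fvt e ->
      derivable R (⟦Assign x e⟧ p ↔ All x (Eq (Var x) e → p))
  | ax_assign_ghost x y e p : y != x -> y \notin fvf p ->
      derivable R
        (⟦Assign x e⟧ p ↔ ⟦Assign y e⟧ ⟦Assign x (Var y)⟧ p)
  | ax_box_havoc x p : derivable R (⟦Havoc x⟧ p ↔ All x p)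
  | ax_box_choice a b p : derivable R (⟦a ∪ b⟧ p ↔ ⟦a⟧ p ∧ ⟦b⟧ p)
  | ax_box_seq a b p : derivable R (⟦a ;; b⟧ p ↔ ⟦a⟧ ⟦b⟧ p)
  | ax_box_loop a p : derivable R (⟦Loop a⟧ p ↔ p ∧ ⟦a⟧ ⟦Loop a⟧ p)
  | ax_I a p : derivable R (p ∧ ⟦Loop a⟧ (p → ⟦a⟧ p) → ⟦Loop a⟧ p)
  | ax_convergence a x p : fresh x a ->
      derivable R
        (⟦Loop a⟧ (All x (¬ Ge (Num 0) (Var x) → p →
             ⟨a⟩ ⟦Assign x (Add (Var x) (Num (-1)))⟧ p)) →
         All x (p → ⟨Loop a⟩ Ex x (Ge (Num 0) (Var x) ∧ p)))
  | ax_DW s q p : derivable R (⟦ODE s q⟧ p ↔ ⟦ODE s q⟧ (q → p))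
  | ax_DC s q c p :
      derivable R (⟦ODE s q⟧ c →
                   (⟦ODE s q⟧ p ↔ ⟦ODE s (q ∧ c)⟧ p))
  | ax_DE s (i : domf s) q p :
      derivable R
        (⟦ODE s q⟧ p ↔ ⟦ODE s q⟧ ⟦Assign (Diff (val i)) (s i)⟧ p)
  | ax_DI s q e k : explicit s q ->
      fvt e `|` fvt k `<=` [fset Base i | i in domf s] ->
      derivable R ((q → ⟦ODE s q⟧ (Ge (Dif e) (Dif k))) →
                   (⟦ODE s q⟧ (Ge e k) ↔ ⟦Test q⟧ (Ge e k)))
  | ax_DG s q i a b p :
      Base i \notin varsp (ODE s q) `|` fvf p `|` fvt a `|` fvt b ->
      Diff i \notin varsp (ODE s q) `|` fvf p `|` fvt a `|` fvt b ->
      fdisjoint (ode_dvars s) (fvt a `|` fvt b) ->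
      derivable R
        (⟦ODE s q⟧ p ↔
         Ex (Base i)
           (⟦ODE (s.[i <- Add (Mul a (Var (Base i))) b]) q⟧ p))
  | ax_DS i c q p t r :
      Base i \notin fvt c -> Diff i \notin fvt c `|` fvf q ->
      t != r ->
      t \notin [fset Base i; Diff i] `|` fvt c `|` fvf q `|` fvf p ->
      r \notin [fset Base i; Diff i] `|` fvt c `|` fvf q `|` fvf p ->
      let flow u := Assign (Base i) (Add (Var (Base i)) (Mul c (Var u))) in
      derivable R
        (⟦ODE [fmap].[i <- c] q⟧ p ↔
         All t (Ge (Var t) (Num 0) →
           All r (Ge (Var r) (Num 0) ∧ Ge (Var t) (Var r) →
             ⟦flow r⟧ q) →
           ⟦flow t⟧ ⟦Assign (Diff i) c⟧ p))
  | ax_box_refines a b p : derivable R (a ≤ b → ⟦b⟧ p → ⟦a⟧ p)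
  | ax_refl a : derivable R (a ≤ a)
  | ax_trans a b c : derivable R (a ≤ b ∧ b ≤ c → a ≤ c)
  | ax_seq a1 a2 b1 b2 :
      derivable R (a1 ≤ a2 ∧ ⟦a1⟧ (b1 ≤ b2) → a1 ;; b1 ≤ a2 ;; b2)
  | ax_choice_lub a b c : derivable R (a ∪ b ≤ c ↔ a ≤ c ∧ b ≤ c)
  | ax_choice_l a b : derivable R (a ≤ a ∪ b)
  | ax_choice_r a b : derivable R (b ≤ a ∪ b)
  | ax_seq_assoc a b c : derivable R ((a ;; b) ;; c ≡ a ;; (b ;; c))
  | ax_seq_id_l a : derivable R (Test Tt ;; a ≡ a)
  | ax_seq_id_r a : derivable R (a ;; Test Tt ≡ a)
  | ax_annih_l a : derivable R (Test Ff ;; a ≡ Test Ff)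
  | ax_annih_r a : derivable R (a ;; Test Ff ≡ Test Ff)
  | ax_distr_l a b c : derivable R (a ;; (b ∪ c) ≡ (a ;; b) ∪ (a ;; c))
  | ax_distr_r a b c : derivable R ((a ∪ b) ;; c ≡ (a ;; c) ∪ (b ;; c))
  | ax_test p q : derivable R (Test p ≤ Test q ↔ (p → q))
  | ax_test_and p q : derivable R (Test p ;; Test q ≡ Test (p ∧ q))
  | ax_test_or p q : derivable R (Test p ∪ Test q ≡ Test (p ∨ q))
  | ax_unfold_l a : derivable R (Test Tt ∪ (a ;; Loop a) ≡ Loop a)
  | ax_unfold_r a : derivable R (Test Tt ∪ (Loop a ;; a) ≡ Loop a)
  | ax_loop_l a b : derivable R (⟦Loop a⟧ (a ;; b ≤ b) → Loop a ;; b ≤ b)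
  | ax_loop_r a b : derivable R (b ;; a ≤ b → b ;; Loop a ≤ b)
  | ax_unloop a b : derivable R (⟦Loop a⟧ (a ≤ b) → Loop a ≤ Loop b)
  | ax_stutter x : derivable R (Assign x (Var x) ≡ Test Tt)
  | ax_assign_refines x e : derivable R (Assign x e ≤ Havoc x)
  | ax_assign_havoc x e : x \notin fvt e ->
      derivable R (Assign x e ≡ Havoc x ;; Test (Eq (Var x) e))
  | ax_assign_absorb x e : derivable R (Assign x e ;; Havoc x ≡ Havoc x)
  | ax_havoc_idem x : derivable R (Havoc x ;; Havoc x ≡ Havoc x)
  | ax_havoc_comm x a : fresh x a ->
      derivable R (Havoc x ;; a ≡ a ;; Havoc x)
  | ax_ode_DW s q : derivable R (ODE s q ≡ ODE s q ;; Test q)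
  | ax_ode_DE s (i : domf s) q :
      derivable R (ODE s q ≡ ODE s q ;; Assign (Diff (val i)) (s i))
  | ax_ode_DR s q p : derivable R (⟦ODE s q⟧ p → ODE s q ≤ ODE s p)
  | ax_ode_rhs s (i : domf s) q e :
      derivable R (⟦ODE s q⟧ (Eq (Var (Diff (val i))) e) →
                   ODE s q ≤ ODE (s.[val i <- e]) q)
  | ax_ode_zero s q : derivable R (Test (ode_holds s q) ≤ ODE s q)
  | ax_ode_idem s q : explicit s q ->
      derivable R (ODE s q ;; ODE s q ≡ ODE s q)
  | ax_ode_prime s (i : domf s) q : Diff (val i) \notin fvp (ODE s q) ->
      derivable R (Havoc (Diff (val i)) ;; ODE s q ≡ ODE s q).

Arguments derivable R p%_drl.

Inductive ctx :=
  | Hole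
  | CSeqR of program & ctx
  | CSeqL of ctx & program
  | CChoiceL of ctx & program
  | CChoiceR of program & ctx
  | CLoop of ctx.

Fixpoint plug (C : ctx) (a : program) : program :=
  match C with
  | Hole => a
  | CSeqR g C => Seq g (plug C a)
  | CSeqL C g => Seq (plug C a) g
  | CChoiceL C g => Choice (plug C a) g
  | CChoiceR g C => Choice g (plug C a)
  | CLoop C => Loop (plug C a)
  end.

Fixpoint fresh_ctx (x : var) (C : ctx) : bool :=
  match C with
  | Hole => true
  | CSeqR g C | CSeqL C g | CChoiceL C g | CChoiceR g C =>
      fresh x g && fresh_ctx x C
  | CLoop C => fresh_ctx x C
  end.

(* Main.v *)
Require Import Defs.
From Stdlib Require Import Morphisms.
From mathcomp Require Import all_boot all_order all_algebra.
From mathcomp Require Import finmap reals.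

Set Implicit Arguments.
Unset Strict Implicit.

Local Open Scope fset_scope.
Local Open Scope drl_scope.

(** Write h for [x := *].  Left to right, [skip ≤ h] and contexts are monotone.
    Right to left, induct on the context: h commutes with the programs of the
    context because x is fresh in them.  Only a loop of a context needs more:
    to fold the iterations, h must move rightwards past C(a), which may write x
    but does not read its initial value.  For any program p without x free,
    [h; p ≤ p; h] follows by induction on p.  Since x may be free in the second
    part of a sequence whose first part always writes x, the induction
    simultaneously shows that [h; p ≤ p] if p writes x on every run. *)

(** * Derivable refinement as a preorder on programs *)

Definition refines (R : realType) (a b : program) : Prop := derivable R (a ≤ b).

Definition equivalent (R : realType) (a b : program) : Prop :=
  derivable R (a ≡ b).

Lemma derivable_and (R : realType) (p q : formula) :
  derivable R p -> derivable R q -> derivable R (p ∧ q).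
Proof.
move=> dp dq; apply: (rule_MP _ dq); apply: (rule_MP _ dp).
by apply: ax_taut => v /=; do 2!case: peval.
Qed.

Lemma derivable_andl (R : realType) (p q : formula) :
  derivable R (p ∧ q) -> derivable R p.
Proof. by apply/rule_MP/ax_taut => v /=; do 2!case: peval. Qed.

Lemma derivable_andr (R : realType) (p q : formula) :
  derivable R (p ∧ q) -> derivable R q.
Proof. by apply/rule_MP/ax_taut => v /=; do 2!case: peval. Qed.

Lemma equivalent_le (R : realType) (a b : program) :
  equivalent R a b -> refines R a b.
Proof. exact: derivable_andl. Qed.

Lemma equivalent_ge (R : realType) (a b : program) :
  equivalent R a b -> refines R b a.
Proof. exact: derivable_andr. Qed.

Lemma refines_antisym (R : realType) (a b : program) :
  refines R a b -> refines R b a -> equivalent R a b.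
Proof. exact: derivable_and. Qed.

Lemma refines_refl (R : realType) (a : program) : refines R a a.
Proof. exact: ax_refl. Qed.

#[export] Hint Resolve refines_refl : core.

(** This and the following instances let [rewrite] use derivable refinements as inequalities under
    the program constructors. *)
#[export] Instance refines_preorder (R : realType) : PreOrder (refines R).
Proof.
split=> [a | a b c ab bc] //.
by apply: (rule_MP (ax_trans R a b c)); apply: derivable_and.
Qed.

#[export] Instance refines_rewrite (R : realType) :
  RewriteRelation (refines R) := {}.

#[export] Instance equivalent_equivalence (R : realType) :
  Equivalence (equivalent R).
Proof.
split=> [a | a b ab | a b c ab bc]; apply: refines_antisym => //.
- exact: equivalent_ge.
- exact: equivalent_le.
- by transitivity b; apply: equivalent_le.
- by transitivity b; apply: equivalent_ge.
Qed.

#[export] Instance equivalent_refines (R : realType) :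
  subrelation (equivalent R) (refines R).
Proof. by move=> a b; apply: equivalent_le. Qed.

#[export] Instance refines_equivalent (R : realType) :
  Proper (equivalent R ==> equivalent R ==> iff) (refines R).
Proof.
move=> a1 a2 a12 b1 b2 b12; split=> ?.
  transitivity a1; first exact: equivalent_ge.
  by transitivity b1; last exact: equivalent_le.
transitivity a2; first exact: equivalent_le.
by transitivity b2; last exact: equivalent_ge.
Qed.

#[export] Instance Seq_refines (R : realType) :
  Proper (refines R ==> refines R ==> refines R) Seq.
Proof.
move=> a1 a2 a12 b1 b2 b12; apply: (rule_MP (ax_seq R a1 a2 b1 b2)).
(* The axiom asks for [b1 ≤ b2] only after [a1]; being derivable, it holds there by
   generalization. *)
by apply: derivable_and => //; apply: rule_G.
Qed.

Lemma choice_lub (R : realType) (a b c : program) :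
  refines R a c -> refines R b c -> refines R (a ∪ b) c.
Proof.
move=> ac bc; apply: (rule_MP (derivable_andr (ax_choice_lub R a b c))).
exact: derivable_and ac bc.
Qed.

Lemma choice_l (R : realType) (a b : program) : refines R a (a ∪ b).
Proof. exact: ax_choice_l. Qed.

Lemma choice_r (R : realType) (a b : program) : refines R b (a ∪ b).
Proof. exact: ax_choice_r. Qed.

#[export] Instance Choice_refines (R : realType) :
  Proper (refines R ==> refines R ==> refines R) Defs.Choice.
Proof.
move=> a1 a2 a12 b1 b2 b12; apply: choice_lub.
  by transitivity a2 => //; apply: choice_l.
by transitivity b2 => //; apply: choice_r.
Qed.

#[export] Instance Loop_refines (R : realType) :
  Proper (refines R ==> refines R) Loop.
Proof.
by move=> a b ab; apply: (rule_MP (ax_unloop R a b)); apply: rule_G.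
Qed.

#[export] Instance Seq_equivalent (R : realType) :
  Proper (equivalent R ==> equivalent R ==> equivalent R) Seq.
Proof.
move=> a1 a2 a12 b1 b2 b12; apply: refines_antisym.
  by rewrite a12 b12.
by rewrite -a12 -b12.
Qed.

(** * Laws of Kleene algebra *)

Lemma seqA (R : realType) (a b c : program) :
  equivalent R ((a ;; b) ;; c) (a ;; b ;; c).
Proof. exact: ax_seq_assoc. Qed.

Lemma skip_seq (R : realType) (a : program) : equivalent R (Test Tt ;; a) a.
Proof. exact: ax_seq_id_l. Qed.

Lemma seq_skip (R : realType) (a : program) : equivalent R (a ;; Test Tt) a.
Proof. exact: ax_seq_id_r. Qed.

Lemma seq_choicer (R : realType) (a b c : program) :
  equivalent R (a ;; (b ∪ c)) ((a ;; b) ∪ (a ;; c)).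
Proof. exact: ax_distr_l. Qed.

Lemma seq_choicel (R : realType) (a b c : program) :
  equivalent R ((a ∪ b) ;; c) ((a ;; c) ∪ (b ;; c)).
Proof. exact: ax_distr_r. Qed.

Lemma loop_unfold_l (R : realType) (a : program) :
  equivalent R (Test Tt ∪ (a ;; Loop a)) (Loop a).
Proof. exact: ax_unfold_l. Qed.

Lemma loop_unfold_r (R : realType) (a : program) :
  equivalent R (Test Tt ∪ (Loop a ;; a)) (Loop a).
Proof. exact: ax_unfold_r. Qed.

Lemma loop_refl (R : realType) (a : program) : refines R (Test Tt) (Loop a).
Proof. by rewrite -loop_unfold_l; apply: choice_l. Qed.

Lemma loop_step_l (R : realType) (a : program) :
  refines R (a ;; Loop a) (Loop a).
Proof. by rewrite -{2}(loop_unfold_l R a); apply: choice_r. Qed.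

Lemma loop_step_r (R : realType) (a : program) :
  refines R (Loop a ;; a) (Loop a).
Proof. by rewrite -{2}(loop_unfold_r R a); apply: choice_r. Qed.

Lemma loop_ind_l (R : realType) (a b c : program) :
  refines R c b -> refines R (a ;; b) b -> refines R (Loop a ;; c) b.
Proof.
move=> cb ab; rewrite cb.
by apply: (rule_MP (ax_loop_l R a b)); apply: rule_G.
Qed.

Lemma loop_ind_r (R : realType) (a b c : program) :
  refines R c b -> refines R (b ;; a) b -> refines R (c ;; Loop a) b.
Proof. by move=> cb ba; rewrite cb; apply/rule_MP/ba/ax_loop_r. Qed.

(** * Moving nondeterministic assignments through programs *)

(** Skipping amounts to [x := x], one of the choices of [x := *]. *)
Lemma skip_havoc (R : realType) (x : var) : refines R (Test Tt) (Havoc x).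
Proof.
have xx : equivalent R (Assign x (Var x)) (Test Tt) by apply: ax_stutter.
by rewrite -xx; apply: ax_assign_refines.
Qed.

Lemma havoc_idem (R : realType) (x : var) :
  equivalent R (Havoc x ;; Havoc x) (Havoc x).
Proof. exact: ax_havoc_idem. Qed.

Lemma refines_seq_havoc (R : realType) (x : var) (a : program) :
  refines R a (a ;; Havoc x).
Proof. by rewrite -{1}(seq_skip R a) skip_havoc. Qed.

Lemma havoc_comm (R : realType) (x : var) (a : program) :
  fresh x a -> equivalent R (Havoc x ;; a) (a ;; Havoc x).
Proof. exact: ax_havoc_comm. Qed.

(** Induction from the right with invariant [Loop a ;; Havoc x]: each new iteration passes to the
    left of [Havoc x] and joins the loop. *)
Lemma havoc_loop (R : realType) (x : var) (a : program) :
  refines R (Havoc x ;; a) (a ;; Havoc x) ->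
  refines R (Havoc x ;; Loop a) (Loop a ;; Havoc x).
Proof.
move=> ha; apply: loop_ind_r; first by rewrite -loop_refl skip_seq.
by rewrite seqA ha -seqA loop_step_r.
Qed.

Lemma havoc_nonfree (R : realType) (x : var) (a : program) :
  x \notin fvp a ->
  refines R (Havoc x ;; a) (a ;; Havoc x) /\
  (x \in mbvp a -> refines R (Havoc x ;; a) a).
Proof.
(* An atomic program either overwrites [x] on every run, and then absorbs [Havoc x], or never writes
   it, and then commutes with [Havoc x]. The next two facts settle these cases. *)
have absorb b : refines R (Havoc x ;; b) b ->
    refines R (Havoc x ;; b) (b ;; Havoc x) /\
    (x \in mbvp b -> refines R (Havoc x ;; b) b).
  by move=> hb; split=> //; rewrite hb; apply: refines_seq_havoc.
have commute b : x \notin fvp b -> x \notin bvp b -> mbvp b `<=` bvp b ->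
    refines R (Havoc x ;; b) (b ;; Havoc x) /\
    (x \in mbvp b -> refines R (Havoc x ;; b) b).
  move=> xFb xBb sb; split=> [|xb]; last first.
    by rewrite (fsubsetP sb _ xb) in xBb.
  apply/equivalent_le/havoc_comm.
  by rewrite /fresh /varsp in_fsetU (negPf xFb) (negPf xBb).
elim: a => [q|y e|y|s q|a IHa b IHb|a IHa b IHb|a IHa] /= xF.
- exact: (commute (Test q)).
- have [yx|yx] := eqVneq y x; last by apply: commute; rewrite //= in_fset1 eq_sym.
  rewrite yx; apply: absorb.
  (* As [e] does not read [x], the assignment is an arbitrary choice of [x] followed by a test, and
     that choice absorbs the earlier one. *)
  have xe : equivalent R (Assign x e) (Havoc x ;; Test (Eq (Var x) e)).
    exact: ax_assign_havoc.
  by rewrite xe -seqA havoc_idem.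
- have [yx|yx] := eqVneq y x; last by apply: commute; rewrite //= in_fset1 eq_sym.
  by rewrite yx; apply: absorb; rewrite havoc_idem.
- have [xs|xs] := orP (orbN (x \in ode_vars s)); last exact: (commute (ODE s q)).
  (* An evolving base variable is free in the ODE, so [x] is the differential variable of one, whose
     initial value the ODE discards. *)
  case/fsetUP: xs => [xs|/imfsetP[i /= si xi]].
    by rewrite !in_fsetU xs in xF.
  apply: absorb; rewrite xi in xF *.
  by apply: equivalent_le; apply: (@ax_ode_prime R s [`si] q).
- move: xF; rewrite in_fsetU negb_or => /andP[/IHa[ha ma] /IHb[hb mb]].
  split; first by rewrite seq_choicer seq_choicel ha hb.
  by rewrite in_fsetI => /andP[/ma {}ma /mb {}mb]; rewrite seq_choicer ma mb.
- move: xF; rewrite in_fsetU negb_or in_fsetD => /andP[/IHa[ha ma]].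
  (* If [a] always writes [x], it absorbs [Havoc x] even when [b] reads [x]. Otherwise [x] is not
     free in [b], so both induction hypotheses apply. *)
  have [xa _|xa /= /IHb[hb mb]] := boolP (x \in mbvp a).
    by apply: absorb; rewrite -seqA (ma xa).
  split; first by rewrite -seqA ha seqA hb seqA.
  by rewrite in_fsetU (negPf xa) /= => /mb {}mb; rewrite -seqA ha seqA mb.
- by have [ha _] := IHa xF; split=> //; apply: havoc_loop.
Qed.

(** * Program contexts *)

Lemma plug_nonfree (C : ctx) (a : program) (x : var) :
  fresh_ctx x C -> x \notin fvp a -> x \notin fvp (plug C a).
Proof.
move=> xC xa; elim: C xC => //= [g C IHC|C IHC g|C IHC g|g C IHC];
  rewrite /fresh /varsp in_fsetU negb_or => /andP[/andP[xg _] /IHC xCa];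
  by rewrite !in_fsetU ?in_fsetD ?negb_or ?negb_and ?xg ?xCa ?orbT.
Qed.

Lemma plug_refines (R : realType) (C : ctx) (a b : program) :
  refines R a b -> refines R (plug C a) (plug C b).
Proof.
by move=> ab; elim: C => //= [g C IHC|C IHC g|C IHC g|g C IHC|C IHC]; rewrite IHC.
Qed.

Lemma plug_havoc (R : realType) (C : ctx) (a : program) (x : var) :
  fresh_ctx x C -> x \notin fvp a ->
  refines R (plug C (a ;; Havoc x) ;; Havoc x) (plug C a ;; Havoc x).
Proof.
move=> xC xa; elim: C xC => /= [_|g C IHC|C IHC g|C IHC g|g C IHC|C IHC].
- by rewrite seqA havoc_idem.
- by move=> /andP[_ /IHC {}IHC]; rewrite !seqA IHC.
- move=> /andP[/(havoc_comm R) hg /IHC {}IHC].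
  (* On both sides, [Havoc x] moves left across [g], next to the plugged context, where the
     induction hypothesis applies. *)
  by rewrite !seqA -hg -!seqA IHC.
- by move=> /andP[_ /IHC {}IHC]; rewrite !seq_choicel IHC.
- by move=> /andP[_ /IHC {}IHC]; rewrite !seq_choicel IHC.
move=> xC; have [hCa _] := havoc_nonfree R (plug_nonfree xC xa).
apply: loop_ind_l; first by rewrite -loop_refl skip_seq.
(* Between the first iteration and the following ones, insert [x := *]. *)
rewrite {1}(refines_seq_havoc R x (plug C (a ;; Havoc x))) (IHC xC) seqA.
(* The inserted assignment moves right across the remaining iterations of [plug C a] and merges with
   the final one. *)
rewrite -(seqA R (Havoc x)) (havoc_loop hCa) seqA havoc_idem.
by rewrite -seqA loop_step_l.
Qed.

Theorem theorem2 (R : realType) (C : ctx) (a : program) (x : var) :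
  fresh_ctx x C -> x \notin fvp a ->
  derivable R (plug C a ;; Havoc x ≡ plug C (a ;; Havoc x) ;; Havoc x).
Proof.
move=> xC xa; apply: derivable_and.
  by apply: Seq_refines => //; apply/plug_refines/refines_seq_havoc.
exact: plug_havoc.
Qed.
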